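(* Let $h_1,h_2,h_3$ be integers with $0<h_1\le h_2\le h_3$. For every integer $n\ge 1$ let $$P^{(n)}_{(h_1,h_2,h_3)}(x)=T_0+\sum_{j=0}^{n-1}\bigl(-h_1T_{6j+1}+h_2T_{6j+2}-h_3T_{6j+3}+h_1T_{6j+4}-h_2T_{6j+5}+h_3T_{6j+6}\bigr)+T_{6n+1}$$ (each $T_i=T_i(x)$), i.e. the polynomial of degree $6n+1$ with Chebyshev coordinates $$[1,-h_1,h_2,-h_3,h_1,-h_2,h_3,\ldots,-h_1,h_2,-h_3,h_1,-h_2,h_3,1].$$ Then $P^{(n)}_{(h_1,h_2,h_3)}(x)$ is hyperbolic, with all roots in the interval $[-2,2]$ except for one root $x_m=x_m(n)$, which is less than $-2$. Moreover $\lim_{n\to\infty}x_m=z_0+z_0^{-1}$, where $z_0$ is the smallest real root of the polynomial $z^3+h_3z^2-h_2z+h_1+1$, while the largest root $x_M=x_M(n)$ tends to $2$ as $n\to\infty$.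
   Context: The Chebyshev polynomials used here are the monic integer polynomials $T_0(x)=1$ and, for $n>0$, $T_n(x)=x^n+\sum_{k=1}^{\lfloor n/2\rfloor}(-1)^k\frac nk\binom{n-k-1}{k-1}x^{n-2k}$; equivalently, for $n>0$, $T_n(2\cos\theta)=2\cos(n\theta)$ and $T_n(z+z^{-1})=z^n+z^{-n}$. Note the convention $T_0=1$ (not $2$). A polynomial has Chebyshev coordinates $[c_0,c_1,\ldots,c_d]$ if it equals $\sum_{j=0}^d c_jT_j(x)$. A real polynomial is called hyperbolic if all its complex roots are real. Roots are counted with multiplicity. *)

(* Defs.v *)
From mathcomp Require Import all_boot all_order all_algebra.
From mathcomp Require Import complex.

Set Implicit Arguments.
Unset Strict Implicit.
Unset Printing Implicit Defensive.

Import Order.TTheory GRing.Theory Num.Theory.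

Local Open Scope ring_scope.

(* The monic Chebyshev polynomials, T_n(z + 1/z) = z^n + z^-n for n > 0.
   For n = 0 the sum is empty, so this is the convention T_0 = 1, not 2.
   The quotient n / k is taken in the field; the coefficients are integers. *)
Definition chebT (R : numFieldType) (n : nat) : {poly R} :=
  'X^n + \sum_(1 <= k < n./2.+1)
    ((-1) ^+ k * (n%:R / k%:R) * 'C(n - k - 1, k - 1)%:R) *: 'X^(n - 2 * k).

Definition chebP (R : numFieldType) (h1 h2 h3 : int) (n : nat) : {poly R} :=
  chebT R 0
  + \sum_(0 <= j < n)
      (- (h1%:~R *: chebT R (6 * j + 1)) + h2%:~R *: chebT R (6 * j + 2)
       - h3%:~R *: chebT R (6 * j + 3) + h1%:~R *: chebT R (6 * j + 4)
       - h2%:~R *: chebT R (6 * j + 5) + h3%:~R *: chebT R (6 * j + 6))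
  + chebT R (6 * n + 1).

Definition limit_cubic (R : numFieldType) (h1 h2 h3 : int) : {poly R} :=
  'X^3 + h3%:~R *: 'X^2 - h2%:~R *: 'X + (h1 + 1)%:~R%:P.

Definition hyperbolic (R : rcfType) (p : {poly R}) : Prop :=
  forall z : complex R, root (map_poly (real_complex R) p) z -> complex.Im z = 0.

Definition smallest_root (R : realFieldType) (p : {poly R}) (a : R) : Prop :=
  root p a /\ forall y : R, root p y -> a <= y.

Definition largest_root (R : realFieldType) (p : {poly R}) (a : R) : Prop :=
  root p a /\ forall y : R, root p y -> y <= a.

(* Multiplicity is part of the claim: a is a simple root of p. *)
Definition only_root_outside (R : realFieldType) (p : {poly R}) (a : R) : Prop :=
  mup a p = 1%N /\ forall y : R, root p y -> y != a -> y \in `[-2, 2].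

(* Main.v *)
Require Import Defs.
From mathcomp Require Import all_boot all_order all_algebra.
From mathcomp Require Import complex polyrcf.
From mathcomp Require Import all_classical all_reals all_analysis.
From mathcomp Require Import zify ring lra.
Set Implicit Arguments.
Unset Strict Implicit.
Unset Printing Implicit Defensive.
Import Order.TTheory GRing.Theory Num.Theory.
Import numFieldNormedType.Exports.
Local Open Scope classical_set_scope.
Local Open Scope ring_scope.

(* On x = z + 1/z, multiplying P^(n) by 1 + z^3 telescopes it:
     (1 + z^3) P^(n)(x) = z^(6n+1) L(z) + z^-(6n+1) L*(z) + m(z),
   where L = z^3 + h3 z^2 - h2 z + h1 + 1 is the limit cubic, L* its reciprocal
   and m = (1 - h3)(1 + z^3) + (h2 - h1)(z + z^2). For z = e^(iu), dividing by
   2 z^(3/2) gives cos(3u/2) P^(n)(2 cos u) = |L(z)| cos Phi(u) + M(u).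
   The cubic is (z - z0)(z^2 + p z + q) with z0 < -1 and the other two roots in
   the closed disc, so Phi is continuous with Phi(0) = 0 and
   Phi(u) >= (6n + 1/2) u; hence Phi takes the values k pi, 0 <= k <= 6n, in
   order on [0, pi). Since |M| < |L|, the polynomial (X - 1) P^(n) of degree
   6n + 2 alternates in sign at the points 2 cos u_k; together with x = -2 and
   x = -oo this gives 6n + 2 sign changes, so all its roots are real and simple
   and exactly one is below -2. When h1 = h2 = h3, |M| = |L| = 0 at u = pi/3,
   and the same argument is run after cancelling the common factor
   z^2 - z + 1.
   For fixed z < -1 the term z^(6n+1) L(z) dominates, so the sign of P^(n) at
   z + 1/z is eventually that of L(z), which traps x_m near z0 + 1/z0. Finally
   P^(n)(2) = 3 while P^(n)(2 cos(pi/6n)) < 0 for large n, so x_M tends to 2. *)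

(** * Chebyshev polynomials *)

(* The absolute value of the coefficient of X^(n-2k) in T_n; the match keeps
   it equal to 0 for all k > n/2 in spite of truncated subtraction. *)
Definition cheb_coef (n k : nat) : nat :=
  if k is k'.+1 then
    ('C(n - k, k) + (if (n - k)%N is m.+1 then 'C(m, k') else 0))%N
  else 1%N.

Lemma cheb_coef_eq0 n k : (n < k.*2)%N -> cheb_coef n k = 0%N.
Proof.
case: k => [|k] //= nk; rewrite bin_small; last lia.
by case E: (n - k.+1)%N => [|m] //; rewrite bin_small //; lia.
Qed.

(** Pascal's rule, applied to both binomials. The indices start at [n.+3] because the convention T_0
    = 1 breaks the recurrence at T_2. *)
Lemma cheb_coefS n k :
  cheb_coef n.+3 k.+1 = (cheb_coef n.+2 k.+1 + cheb_coef n.+1 k)%N.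
Proof.
case: k => [|k] /=.
  by rewrite !bin1 subn1 /= !bin0; case: n => [|n] /=; rewrite ?bin0; lia.
rewrite !subSS.
case: (leqP k n) => [kn|nk]; last first.
  have -> : (n.+1 - k = 0)%N by lia.
  by have -> : (n - k = 0)%N by lia.
rewrite subSn //; case: (n - k)%N => [|m] //=.
by rewrite binS (binS m k); lia.
Qed.

(** With n = m + 1 + k, the identity (m + 1) C(m, k - 1) = k C(m + 1, k) splits n/k C(m, k - 1) into
    C(m + 1, k) + C(m, k - 1). *)
Lemma cheb_coefE (R : numFieldType) n k : (0 < k)%N -> (k.*2 <= n)%N ->
  n%:R / k%:R * 'C(n - k - 1, k - 1)%:R = (cheb_coef n k)%:R :> R.
Proof.
case: k => [//|k] _ kn; rewrite /cheb_coef !subn1.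
have [m nE] : exists m, (n - k.+1 = m.+1)%N by exists (n - k.+2)%N; lia.
rewrite nE /=; have -> : n = (m.+1 + k.+1)%N by lia.
have k0 : k.+1%:R != 0 :> R by rewrite pnatr_eq0.
apply: (mulfI k0); rewrite mulrA mulrCA divff // mulr1.
rewrite -!natrM mulnDr -mul_bin_diag /=; congr (_%:R).
by lia.
Qed.

(** The free bound [K] lets consecutive T_n be summed over matching ranges in the recurrence; the
    extra terms vanish. *)
Lemma chebT_sumE (R : numFieldType) n K : (n./2 < K)%N ->
  chebT R n =
  \sum_(0 <= k < K) ((-1) ^+ k * (cheb_coef n k)%:R) *: 'X^(n - 2 * k).
Proof.
move=> nK; rewrite (@big_cat_nat _ _ _ n./2.+1) //= [X in _ + X]big_nat_cond.
rewrite [X in _ + X]big1 => [|k /andP[/andP[nk _] _]]; last first.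
  by rewrite cheb_coef_eq0 ?mulr0 ?scale0r //; lia.
rewrite addr0 big_ltn // expr0 mulr1 scale1r muln0 subn0 /chebT.
congr (_ + _); apply: eq_big_nat => k /andP[k0 kn].
by rewrite -mulrA cheb_coefE //; lia.
Qed.

Lemma chebT0 (R : numFieldType) : chebT R 0 = 1.
Proof. by rewrite /chebT big_geq // addr0. Qed.

Lemma chebT1 (R : numFieldType) : chebT R 1 = 'X.
Proof. by rewrite /chebT big_geq // addr0. Qed.

Lemma chebT2 (R : numFieldType) : chebT R 2 = 'X^2 - 2%:P.
Proof.
rewrite (@chebT_sumE R 2 2) // big_nat_recl // big_nat1 /= !expr0 expr1.
by rewrite mulr1 scale1r mulN1r scaleNr -mul_polyC mulr1.
Qed.

Lemma chebTS (R : numFieldType) n :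
  chebT R n.+3 = 'X * chebT R n.+2 - chebT R n.+1.
Proof.
rewrite (@chebT_sumE R n.+3 n.+4) ?(@chebT_sumE R n.+2 n.+4); [|lia..].
rewrite (@chebT_sumE R n.+1 n.+3); last lia.
rewrite big_nat_recl // [X in 'X * X]big_nat_recl // mulrDr -addrA.
congr (_ + _).
  by rewrite !mulr1 !scale1r !muln0 !subn0 -exprS.
rewrite mulr_sumr -sumrB; apply: eq_bigr => k _.
rewrite cheb_coefS natrD mulrDr scalerDl; congr (_ + _).
  rewrite -scalerAr -exprS; case: (leqP k.+1.*2 n.+2) => kn.
    by congr (_ *: 'X^_); lia.
  by rewrite cheb_coef_eq0 // mulr0 !scale0r.
rewrite exprS mulN1r mulNr scaleNr; congr (- (_ *: 'X^_)); lia.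
Qed.

(** Serves both z^n + z^-n and 2 cos (n x). Index 0 is left out: both formulas give 2 there, not T_0
    = 1. *)
Lemma horner_chebT_rec (R : numFieldType) (x : R) (f : nat -> R) :
  f 1%N = x -> f 2%N = x ^+ 2 - 2 ->
  (forall n, f n.+3 = x * f n.+2 - f n.+1) ->
  forall n, (0 < n)%N -> (chebT R n).[x] = f n.
Proof.
move=> f1 f2 fS [//|n] _.
suff [] : (chebT R n.+1).[x] = f n.+1 /\ (chebT R n.+2).[x] = f n.+2 by [].
elim: n => [|n [IH1 IH2]].
  by rewrite chebT1 chebT2 !hornerE f1 f2.
by split=> //; rewrite chebTS fS hornerD hornerN hornerM hornerX IH1 IH2.
Qed.

Lemma horner_chebT_addV (R : numFieldType) (z : R) n : z != 0 -> (0 < n)%N ->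
  (chebT R n).[z + z^-1] = z ^+ n + z ^- n.
Proof.
move=> z0; apply: (@horner_chebT_rec _ _ (fun n => z ^+ n + z ^- n)) => //.
- by field.
- by move=> k; rewrite !exprS; field; rewrite expf_neq0 // z0.
Qed.

Lemma chebT_size_monic (R : numFieldType) n :
  size (chebT R n) = n.+1 /\ chebT R n \is monic.
Proof.
suff lt : (size (chebT R n - 'X^n)%R < size ('X^n : {poly R})%R)%N.
  rewrite -[chebT R n](subrK 'X^n) addrC; split.
    by rewrite size_polyDl // size_polyXn.
  by rewrite monicE lead_coefDl // lead_coefXn.
rewrite size_polyXn ltnS /chebT addrAC subrr add0r.
apply: (leq_trans (size_sum _ _ _)); apply/bigmax_leqP_seq => k.
rewrite mem_index_iota => /andP[k0 kn] _.
by apply: (leq_trans (size_scale_leq _ _)); rewrite size_polyXn; lia.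
Qed.

Lemma chebP_size_monic (R : numFieldType) h1 h2 h3 n :
  size (chebP R h1 h2 h3 n) = (6 * n + 2)%N /\ chebP R h1 h2 h3 n \is monic.
Proof.
have [sT mT] := chebT_size_monic R (6 * n + 1).
have szT a k : (k <= 6 * n)%N -> (size (a *: chebT R k) <= 6 * n + 1)%N.
  move=> kn; apply: (leq_trans (size_scale_leq _ _)).
  by rewrite (chebT_size_monic R k).1; lia.
rewrite /chebP; set S := _ + \sum_(_ <= _ < _) _.
have lt : (size S < size (chebT R (6 * n + 1)))%N.
  rewrite sT addn1 ltnS -addn1.
  apply: (leq_trans (size_polyD _ _)); rewrite geq_max; apply/andP; split.
    by rewrite -[chebT R 0]scale1r; apply: szT.
  apply: (leq_trans (size_sum _ _ _)); apply/bigmax_leqP_seq => k.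
  rewrite mem_index_iota => /andP[_ kn] _.
  by do ![apply: (leq_trans (size_polyD _ _)); rewrite geq_max; apply/andP; split];
     rewrite ?size_polyN; apply: szT; lia.
by rewrite addrC size_polyDl // sT monicE lead_coefDl // -monicE mT; split=> //; lia.
Qed.

(** * Evaluation of P at 2 cos u and at z + 1/z *)

Lemma mulr_cos_cos (R : realType) (a b : R) :
  cos a * (2 * cos b) = cos (b + a) + cos (b - a).
Proof. by rewrite cosD cosB; ring. Qed.

Lemma horner_chebT_cos (R : realType) (x : R) n : (0 < n)%N ->
  (chebT R n).[2 * cos x] = 2 * cos (n%:R * x).
Proof.
apply: (@horner_chebT_rec _ _ (fun n => 2 * cos (n%:R * x))) => [||k].
- by rewrite mul1r.
- by rewrite (mulr_natl x 2) cos_mulr2n; ring.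
- have := mulr_cos_cos x (k.+2%:R * x).
  have -> : k.+2%:R * x + x = k.+3%:R * x by ring.
  have -> : k.+2%:R * x - x = k.+1%:R * x by ring.
  by move=> E; rewrite -mulrA E; ring.
Qed.

Lemma horner_chebP (R : numFieldType) (h1 h2 h3 : int) n (x : R) :
  (chebP R h1 h2 h3 n).[x] =
  1 + \sum_(0 <= j < n)
     (- (h1%:~R * (chebT R (6 * j + 1)).[x]) + h2%:~R * (chebT R (6 * j + 2)).[x]
      - h3%:~R * (chebT R (6 * j + 3)).[x] + h1%:~R * (chebT R (6 * j + 4)).[x]
      - h2%:~R * (chebT R (6 * j + 5)).[x] + h3%:~R * (chebT R (6 * j + 6)).[x])
  + (chebT R (6 * n + 1)).[x].
Proof.
rewrite /chebP 2!hornerD chebT0 hornerC horner_sum; congr (_ + _ + _).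
by apply: eq_bigr => j _; rewrite 5!hornerD !hornerN !hornerZ.
Qed.

(** Multiplication by cos (3t) sends T_k to the frequencies 2k + 3 and 2k - 3. The coefficients
    change sign when the index moves by three, so T_k and T_(k+3) cancel at 2k + 3 and only the ends
    survive. *)
Lemma horner_chebP_cos (R : realType) (h1 h2 h3 : int) n (t : R) :
  let c m := cos (m * t) in
  c 3 * (chebP R h1 h2 h3 n).[2 * cos (2 * t)] =
  c (12 * n%:R + 5) + h3%:~R * c (12 * n%:R + 3)
  - h2%:~R * c (12 * n%:R + 1) + (h1%:~R + 1) * c (12 * n%:R - 1)
  + ((1 - h3%:~R) * c 3 + (h2%:~R - h1%:~R) * c 1).
Proof.
move=> c; rewrite horner_chebP.
have prod j k : (0 < k)%N -> c 3 * (chebT R (6 * j + k)).[2 * cos (2 * t)] =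
    c (12 * j%:R + 2 * k%:R + 3) + c (12 * j%:R + 2 * k%:R - 3).
  move=> k0; rewrite horner_chebT_cos; last lia.
  by rewrite mulr_cos_cos /c; congr (cos _ + cos _); ring.
have cN m m' : m' = - m -> c m' = c m by move=> ->; rewrite /c mulNr cosN.
have tele : c 3 * \sum_(0 <= j < n)
     (- (h1%:~R * (chebT R (6 * j + 1)).[2 * cos (2 * t)])
      + h2%:~R * (chebT R (6 * j + 2)).[2 * cos (2 * t)]
      - h3%:~R * (chebT R (6 * j + 3)).[2 * cos (2 * t)]
      + h1%:~R * (chebT R (6 * j + 4)).[2 * cos (2 * t)]
      - h2%:~R * (chebT R (6 * j + 5)).[2 * cos (2 * t)]
      + h3%:~R * (chebT R (6 * j + 6)).[2 * cos (2 * t)]) =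
   h1%:~R * (c (12 * n%:R - 1) - c 1) - h2%:~R * (c (12 * n%:R + 1) - c 1)
   + h3%:~R * (c (12 * n%:R + 3) - c 3).
  rewrite mulr_sumr.
  elim: n => [|n IH].
    by rewrite big_geq // mulr0 sub0r !add0r (cN 1) //; ring.
  rewrite big_nat_recr //= IH !(mulrDr (c 3)) !mulrN !(mulrCA (c 3)) !prod //.
  have s : n.+1%:R = n%:R + 1 :> R by rewrite -natr1.
  (* [ring] identifies two cosines only if their arguments are the same term, so each frequency is
     brought to one chosen form. *)
  have e (x y : R) : x = y -> c x = c y by move=> ->.
  rewrite (e (12 * n.+1%:R - 1) (12 * n%:R + 2 * 4 + 3)); last by rewrite s; ring.
  rewrite (e (12 * n.+1%:R + 1) (12 * n%:R + 2 * 5 + 3)); last by rewrite s; ring.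
  rewrite (e (12 * n.+1%:R + 3) (12 * n%:R + 2 * 6 + 3)); last by rewrite s; ring.
  rewrite (e (12 * n%:R + 2 * 1 + 3) (12 * n%:R + 2 * 4 - 3)); last by ring.
  rewrite (e (12 * n%:R + 2 * 2 + 3) (12 * n%:R + 2 * 5 - 3)); last by ring.
  rewrite (e (12 * n%:R + 2 * 3 + 3) (12 * n%:R + 2 * 6 - 3)); last by ring.
  rewrite (e (12 * n%:R - 1) (12 * n%:R + 2 * 1 - 3)); last by ring.
  rewrite (e (12 * n%:R + 1) (12 * n%:R + 2 * 2 - 3)); last by ring.
  rewrite (e (12 * n%:R + 3) (12 * n%:R + 2 * 3 - 3)); last by ring.
  ring.
rewrite !mulrDr tele prod // mulr1.
have -> : 12 * n%:R + 2 * 1 + 3 = 12 * n%:R + 5 :> R by ring.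
have -> : 12 * n%:R + 2 * 1 - 3 = 12 * n%:R - 1 :> R by ring.
ring.
Qed.

Definition cubicL (R : pzRingType) (a1 a2 a3 z : R) : R :=
  z ^+ 3 + a3 * z ^+ 2 - a2 * z + (a1 + 1).

(** The same cancellation in the variable z, later applied to real z < -1. The power [(z ^+ 6) ^+ n]
    is kept as one atom for [field]. *)
Lemma horner_chebP_addV (R : numFieldType) (h1 h2 h3 : int) n (z : R) :
  z != 0 ->
  let a1 : R := h1%:~R in let a2 : R := h2%:~R in let a3 : R := h3%:~R in
  (1 + z ^+ 3) * (chebP R h1 h2 h3 n).[z + z^-1] =
  z * (z ^+ 6) ^+ n * cubicL a1 a2 a3 z
  + (z * (z ^+ 6) ^+ n)^-1 * (1 + a3 * z - a2 * z ^+ 2 + (a1 + 1) * z ^+ 3)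
  + ((1 - a3) * (1 + z ^+ 3) + (a2 - a1) * (z + z ^+ 2)).
Proof.
move=> z0 a1 a2 a3; rewrite horner_chebP /cubicL.
have TE j k : (0 < k)%N -> (chebT R (6 * j + k)).[z + z^-1] =
    (z ^+ 6) ^+ j * z ^+ k + (z ^+ 6) ^- j * z ^- k.
  by move=> k0; rewrite horner_chebT_addV //; [rewrite exprD exprM invfM|lia].
have w0 j : (z ^+ 6) ^+ j != 0 by rewrite !expf_neq0.
have tele : (1 + z ^+ 3) * \sum_(0 <= j < n)
     (- (a1 * (chebT R (6 * j + 1)).[z + z^-1])
      + a2 * (chebT R (6 * j + 2)).[z + z^-1]
      - a3 * (chebT R (6 * j + 3)).[z + z^-1]
      + a1 * (chebT R (6 * j + 4)).[z + z^-1]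
      - a2 * (chebT R (6 * j + 5)).[z + z^-1]
      + a3 * (chebT R (6 * j + 6)).[z + z^-1]) =
   ((z ^+ 6) ^+ n - 1) * (a1 * z - a2 * z ^+ 2 + a3 * z ^+ 3)
   + ((z ^+ 6) ^- n - 1) * (a1 * z ^+ 2 - a2 * z + a3).
  rewrite mulr_sumr; elim: n => [|n IH].
    by rewrite big_geq // !expr0 invr1 subrr !mul0r addr0.
  rewrite big_nat_recr //= IH !TE // (exprS _ n); have := w0 n.
  set w := (z ^+ 6) ^+ n => wn; field; by rewrite wn z0.
rewrite !mulrDr tele TE // mulr1; have := w0 n.
set w := (z ^+ 6) ^+ n => wn; field; by rewrite wn z0.
Qed.

Lemma horner_chebP_2 (R : realType) (h1 h2 h3 : int) n :
  (chebP R h1 h2 h3 n).[2] = 3.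
Proof.
have := horner_chebP_cos h1 h2 h3 n (0 : R).
by rewrite /= !mulr0 cos0 !mulr1 mul1r => ->; ring.
Qed.

Lemma exprN1_muln6 (R : comPzRingType) n : (-1) ^+ (6 * n) = 1 :> R.
Proof. by rewrite exprM (_ : (-1) ^+ 6 = 1) ?expr1n //; ring. Qed.

(** At z = -1 the factor 1 + z^3 vanishes and the telescoped identity says nothing, so the blocks
    are summed directly: T_k(-2) = 2 (-1)^k absorbs the alternating signs. *)
Lemma horner_chebP_N2 (R : numFieldType) (h1 h2 h3 : int) n :
  (chebP R h1 h2 h3 n).[-2] = 4 * n%:R * (h1 + h2 + h3)%:~R - 1.
Proof.
have T k : (0 < k)%N -> (chebT R k).[-2] = 2 * (-1) ^+ k.
  move=> k0; have -> : -2 = -1 + (-1)^-1 :> R by rewrite invrN1; ring.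
  rewrite horner_chebT_addV ?oppr_eq0 ?oner_eq0 // -exprVn invrN1; ring.
rewrite horner_chebP (eq_bigr (fun=> 4 * (h1 + h2 + h3)%:~R)) => [|j _].
  by rewrite sumr_const_nat subn0 T ?addn1 // exprS exprN1_muln6 mulr_natr; ring.
by rewrite !T ?addnS ?addn0 // !exprS exprN1_muln6; ring.
Qed.

(** * Counting roots by sign changes *)

(** Up to the sign (-1)^deg p, p(-X) has leading coefficient 1, hence is at least 1 near +oo. *)
Lemma monic_sgr_minfty (R : realFieldType) (p : {poly R}) (b : R) :
  p \is monic -> exists2 y, y < b & 0 < (-1) ^+ (size p).-1 * p.[y].
Proof.
move=> /monicP lp; pose q := (-1) ^+ (size p).-1 *: (p \Po - 'X).
have lq : lead_coef q = 1.
  rewrite lead_coefZ lead_coef_comp ?size_polyN ?size_polyX // lp.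
  by rewrite lead_coefN lead_coefX mul1r -expr2 sqrr_sign.
have [|y Hy] := @poly_pinfty_gt_lc _ q; first by rewrite lq.
exists (- (Num.max y (1 - b))).
  have : 1 - b <= Num.max y (1 - b) by rewrite le_max lexx orbT.
  by lra.
have := Hy (Num.max y (1 - b)).
rewrite le_max lexx /= lq => /(_ isT) /(lt_le_trans ltr01).
by rewrite hornerZ horner_comp hornerN hornerX.
Qed.

(** Each new root lies in the gap just left of [x m] and the earlier ones lie to its right, so they
    are distinct. *)
Lemma alternating_roots (R : rcfType) (p : {poly R}) m (x : nat -> R) :
  (forall k, (k < m)%N -> x k.+1 < x k) ->
  (forall k, (k <= m)%N -> 0 < (-1) ^+ k * p.[x k]) ->
  exists s : seq R,
    [/\ size s = m, uniq s, all (root p) s & all (fun r => x m < r < x 0%N) s].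
Proof.
elim: m => [|m IH] dx sx; first by exists [::].
have [||s [sz us rs bs]] := IH; [by move=> k km; apply: dx; lia|
  by move=> k km; apply: sx; lia|].
have lt := dx m (ltnSn m).
have [|r /itvP rI rr] := @polyrcf.poly_ivtoo R p (x m.+1) (x m) (ltW lt).
  have := mulr_gt0 (sx m (leqnSn m)) (sx m.+1 (leqnn _)).
  by rewrite exprS mulN1r mulrACA mulrN -expr2 sqrr_sign mulN1r oppr_gt0 mulrC.
have x0 : x m <= x 0%N.
  by case: (m) s sz bs {IH us rs lt rI} dx => // m' s sz bs dx;
     elim: m'.+1 dx => // k IHk dx; apply: (le_trans (ltW (dx k _))) => //;
     apply: IHk => j jk; apply: dx; lia.
exists (r :: s); split=> /=.
- by rewrite sz.
- rewrite us andbT; apply/negP => /(allP bs) /andP[].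
  by rewrite ltNge ltW // rI.
- by rewrite rr rs.
- rewrite rI (lt_le_trans _ x0) ?rI //=; apply/allP => y /(allP bs) /andP[y1 y2].
  by rewrite y2 andbT (lt_trans lt).
Qed.

(* The sign changes at the x k, then at -2, then near -oo exhaust the degree. *)
Lemma alternating_split (R : rcfType) (q : {poly R}) m (x : nat -> R) :
  q \is monic -> size q = m.+3 -> x 0%N <= 2 -> -2 < x m ->
  (forall k, (k < m)%N -> x k.+1 < x k) ->
  (forall k, (k <= m)%N -> 0 < (-1) ^+ k * q.[x k]) ->
  0 < (-1) ^+ m.+1 * q.[-2] ->
  exists y0 s, [/\ y0 < -2, all (fun r => -2 < r < 2) s, uniq (y0 :: s) &
                   q = \prod_(r <- y0 :: s) ('X - r%:P)].
Proof.
(* The point -2 is appended at index m + 1; these m + 2 points give m + 1 roots, one short of the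
   degree m + 2. *)
move=> mq sq x0 xm dx sx s2; pose x' k := if (k <= m)%N then x k else -2.
have [|k|s [sz us rs bs]] := @alternating_roots R q m.+1 x'.
- move=> k km; rewrite /x' (_ : (k <= m)%N) //; case: ltnP => [|mk]; first exact: dx.
  by have -> : k = m by lia.
- move=> km; rewrite /x'; case: leqP => [|mk]; first exact: sx.
  by have -> : k = m.+1 by lia.
have [y ylt sy] := monic_sgr_minfty (-2) mq.
have [|y0 /itvP yI ry] := @polyrcf.poly_ivtoo R q y (-2) (ltW ylt).
  have := mulr_gt0 s2 sy; rewrite sq /= [(-1) ^+ m.+2]exprS mulN1r mulrACA mulrN.
  by rewrite -expr2 sqrr_sign mulN1r oppr_gt0 mulrC.
rewrite /x' /= ltnn in bs.
have bs' : all (fun r => -2 < r < 2) s.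
  apply/allP => r /(allP bs) /andP[-> rx] /=.
  exact: lt_le_trans rx x0.
have uy : uniq (y0 :: s).
  rewrite /= us andbT; apply/negP => /(allP bs) /andP[].
  by rewrite ltNge ltW // yI.
exists y0, s; split=> //; first by rewrite yI.
rewrite {1}(@all_roots_prod_XsubC _ q (y0 :: s)).
- by rewrite (monicP mq) scale1r.
- by rewrite sq /= sz.
- by rewrite /= ry.
- by rewrite uniq_rootsE.
Qed.

(** Stated for divisors because for h1 < h3 the sign changes split (X - 1) P, of which P is only a
    factor. *)
Lemma dvdp_split_hyperbolic (R : rcfType) (p : {poly R}) (s : seq R) :
  p %| \prod_(r <- s) ('X - r%:P) -> hyperbolic p.
Proof.
move=> /(dvdpP _) pq z pz; case: pq => u eq.
have : root (map_poly (real_complex R) (\prod_(r <- s) ('X - r%:P))) z.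
  by rewrite eq rmorphM rootM pz orbT.
rewrite rmorph_prod (eq_bigr (fun r => 'X - (real_complex R r)%:P)) => [|r _].
  rewrite -(big_map (real_complex R) xpredT (fun c => 'X - c%:P)).
  by rewrite root_prod_XsubC => /mapP[r _ ->].
by rewrite rmorphB /= map_polyX map_polyC.
Qed.

Lemma dvdp_split_root (R : fieldType) (p : {poly R}) (s : seq R) a :
  p %| \prod_(r <- s) ('X - r%:P) -> root p a -> a \in s.
Proof.
by move=> pq; rewrite -dvdp_XsubCl => /dvdp_trans /(_ pq); rewrite dvdp_XsubCl root_prod_XsubC.
Qed.

Lemma dvdp_uniq_split_mup (R : fieldType) (p : {poly R}) (s : seq R) a :
  uniq s -> p %| \prod_(r <- s) ('X - r%:P) -> root p a -> mup a p = 1%N.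
Proof.
move=> us pq pa; have as' := dvdp_split_root pq pa.
have q0 : \prod_(r <- s) ('X - r%:P) != 0 by rewrite monic_neq0 // monic_prod_XsubC.
have p0 : p != 0 by apply: contraNneq q0 => p0; rewrite p0 dvd0p in pq *.
apply/eqP; rewrite eqn_leq -XsubC_dvd // dvdp_XsubCl pa andbT.
rewrite mup_leq //; apply/negP => /dvdp_trans /(_ pq).
by rewrite -mup_geq // mu_prod_XsubC count_uniq_mem // as'.
Qed.

Lemma largest_root_exists (R : realFieldType) (p : {poly R}) (s : seq R) a :
  {subset root p <= s} -> root p a -> exists b, largest_root p b.
Proof.
move=> ps pa; have {pa} : a \in seq.filter (root p) s by rewrite mem_filter pa ps.
have {ps}: {subset root p <= seq.filter (root p) s}.
  by move=> y py; rewrite mem_filter; apply/andP; split; [exact: py|exact: ps].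
have : all (root p) (seq.filter (root p) s) by exact: filter_all.
move: (seq.filter _ _) => {}s ras sub.
case: s ras sub => // r s ras sub _.
have [b bs bmax] : exists2 b, b \in r :: s & {in r :: s, forall y, y <= b}.
  elim: (s) (r) => [|r1 s1 IH] r0.
    by exists r0; rewrite ?mem_head // => y; rewrite inE => /eqP ->.
  have [b bs bm] := IH r1; case: (leP r0 b) => rb.
    exists b; first by rewrite in_cons bs orbT.
    move=> y.
    by rewrite in_cons => /predU1P[->|/bm].
  exists r0; rewrite ?mem_head // => y.
  by rewrite in_cons => /predU1P[->//|/bm yb]; rewrite (le_trans yb) // ltW.
exists b; split; first exact: (allP ras).
by move=> y py; apply: bmax; apply: sub.
Qed.

(** * Continuous phases *)

(* The argument in [0, pi) of the point (x, y) of the closed upper half-plane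
   off the negative real axis. *)
Definition uarg (R : realType) (x y : R) : R :=
  2 * atan (y / (Num.sqrt (x ^+ 2 + y ^+ 2) + x)).

Lemma uarg_den_gt0 (R : realType) (x y : R) : 0 < x \/ y != 0 ->
  0 < Num.sqrt (x ^+ 2 + y ^+ 2) + x.
Proof.
case=> [x0|y0]; first by rewrite ltr_wpDl ?sqrtr_ge0.
rewrite -ltrBlDr sub0r; apply: (le_lt_trans (ler_norm _)).
by rewrite normrN -sqrtr_sqr ltr_sqrt ?ltrDl ?ltr_pwDr ?sqr_ge0 ?exprn_even_gt0.
Qed.

(** Half-angle formula: tan (phi/2) = sin phi / (1 + cos phi) = y / (r + x). *)
Lemma uargP (R : realType) (x y : R) : 0 < x \/ y != 0 ->
  let r := Num.sqrt (x ^+ 2 + y ^+ 2) in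
  r * cos (uarg x y) = x /\ r * sin (uarg x y) = y.
Proof.
move=> xy r; have d0 : 0 < r + x by exact: uarg_den_gt0.
have r2 : r ^+ 2 = x ^+ 2 + y ^+ 2 by rewrite sqr_sqrtr // addr_ge0 ?sqr_ge0.
have r0 : 0 < r.
  by rewrite lt_neqAle sqrtr_ge0 andbT eq_sym; apply/eqP => r0; case: xy => [|/eqP]; nra.
rewrite /uarg -/r (mulr_natl _ 2) cos_mulr2n sin_mulr2n.
set w := y / (r + x); set a := atan w.
have ca : cos a != 0.
  by rewrite gt_eqF // cos_gt0_pihalf // atan_gtNpi2 atan_ltpi2.
have sa : sin a = w * cos a by rewrite -[w]atanK -/a /tan divfK.
have c2 : cos a ^+ 2 = (r + x) / (2 * r).
  have e : cos a ^+ 2 * (1 + w ^+ 2) = 1.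
    by rewrite mulrDr mulr1 -exprMn [cos a * w]mulrC -sa cos2Dsin2.
  have e2 : 1 + w ^+ 2 = 2 * r / (r + x).
    have y2 : y ^+ 2 = (r - x) * (r + x) by ring: r2.
    by rewrite /w expr_div_n y2; field; rewrite gt_eqF.
  rewrite e2 in e; apply: (mulIf (x := 2 * r / (r + x))).
    by rewrite mulf_neq0 ?invr_neq0 ?mulf_neq0 ?gt_eqF.
  by rewrite e; field; rewrite !gt_eqF.
split; first by rewrite c2; field; rewrite gt_eqF.
rewrite sa mulrCA -expr2 c2 /w; field; by rewrite !gt_eqF.
Qed.

Lemma uarg_ge0 (R : realType) (x y : R) : 0 <= y -> 0 < x \/ y != 0 ->
  0 <= uarg x y.
Proof.
move=> y0 xy; rewrite mulr_ge0 // -atan0 le_atan // divr_ge0 //.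
by rewrite ltW // uarg_den_gt0.
Qed.

Lemma continuous_uarg (R : realType) (f g : R -> R) (a : R) :
  0 < f a \/ g a != 0 -> {for a, continuous f} -> {for a, continuous g} ->
  {for a, continuous (fun x => uarg (f x) (g x))}.
Proof.
move=> fg cf cg; have d0 := uarg_den_gt0 fg.
pose n x := f x ^+ 2 + g x ^+ 2.
have cn : {for a, continuous n} by apply: cvgD; rewrite expr2; exact: cvgM.
have cr : {for a, continuous (Num.sqrt \o n)}.
  by apply: continuous_comp => //; exact: sqrt_continuous.
pose w x := g x / (Num.sqrt (n x) + f x).
have cw : {for a, continuous w}.
  by apply: cvgM => //; apply: cvgV; [rewrite gt_eqF|exact: cvgD].
have ca : {for a, continuous (@atan R \o w)}.
  by apply: continuous_comp => //; exact: continuous_atan.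
by apply: cvgM => //; exact: cvg_cst.
Qed.

Lemma cos_natrpi (R : realType) k : cos (k%:R * pi) = (-1) ^+ k :> R.
Proof.
elim: k => [|k IH]; first by rewrite mul0r cos0.
by rewrite -natr1 mulrDl mul1r cosDpi IH exprS mulN1r.
Qed.

(** The intermediate value theorem is applied to the right of the last point found, which gives the
    order of the points. *)
Lemma phase_points (R : realType) (Phi : R -> R) K :
  (forall x, 0 <= x < pi -> {for x, continuous Phi}) -> Phi 0 = 0 ->
  (forall x, 0 <= x < pi -> (K%:R + 2^-1) * x <= Phi x) ->
  exists u : nat -> R,
    [/\ forall k, (k <= K)%N -> Phi (u k) = k%:R * pi,
        forall k, (k <= K)%N -> 0 <= u k < pi,
        forall k, (k < K)%N -> u k < u k.+1 & u 0%N = 0].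
Proof.
move=> cPhi Phi0 low.
have pi0 := pi_gt0 R; have K0 : 0 < K%:R + 2^-1 :> R by rewrite ltr_wpDl ?ler0n.
(* At [b] the lower bound on [Phi] equals K pi, so all the values are reached within [0, b]; the 1/2
   makes b < pi. *)
pose b : R := K%:R * pi / (K%:R + 2^-1).
have b0 : 0 <= b by rewrite !mulr_ge0 ?ler0n ?invr_ge0 // ltW.
have bpi : b < pi by rewrite ltr_pdivrMr //; lra.
have Pb : K%:R * pi <= Phi b.
  by have := low b; rewrite b0 bpi => /(_ isT); rewrite mulrC divfK // gt_eqF.
suff H j : (j <= K)%N -> exists u : nat -> R,
    [/\ forall k, (k <= j)%N -> Phi (u k) = k%:R * pi,
        forall k, (k <= j)%N -> 0 <= u k <= b,
        forall k, (k < j)%N -> u k < u k.+1 & u 0%N = 0].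
  have [u [u1 u2 u3 u4]] := H K (leqnn K).
  by exists u; split=> // k /u2 /andP[-> /le_lt_trans ->].
elim: j => [_|j IH jK].
  by exists (fun=> 0); split=> // k; rewrite ?lexx // leqn0 => /eqP ->; rewrite mul0r.
have [u [u1 u2 u3 u4]] := IH (ltnW jK).
have /andP[uj0 ujb] := u2 j (leqnn j).
have Puj := u1 j (leqnn j).
have lt1 : j%:R * pi < j.+1%:R * pi :> R by rewrite ltr_pM2r // ltr_nat.
have le2 : j.+1%:R * pi <= Phi b.
  by apply: le_trans Pb; rewrite ler_pM2r // ler_nat.
have [||c /andP[]] := @IVT R Phi (u j) b (j.+1%:R * pi) ujb.
- apply: continuous_in_subspaceT => x; rewrite inE /= in_itv /= => /andP[x1 x2].
  by apply: cPhi; rewrite (le_trans uj0) //= (le_lt_trans x2).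
- by rewrite ge_min le_max Puj (ltW lt1) le2 orbT.
rewrite !bnd_simp => uc cb Pc.
have uc' : u j < c.
  by rewrite lt_neqAle uc andbT; apply/eqP => e; move: lt1; rewrite -Puj -Pc e ltxx.
exists (fun k => if (k <= j)%N then u k else c); split=> //.
- move=> k kj; case: leqP => [|jk]; first exact: u1.
  by have -> : k = j.+1 by apply/eqP; rewrite eqn_leq kj.
- move=> k kj; case: leqP => [|jk]; first exact: u2.
  by rewrite cb (le_trans uj0).
- move=> k; rewrite ltnS => kj; rewrite kj; case: ltnP => [|jk]; first exact: u3.
  by have -> : k = j by apply/eqP; rewrite eqn_leq kj.
Qed.

(** * |M| < |L| on the unit circle *)

(* Four times |L(z)|^2 - M(z)^2 at v = 2 cos(theta) - 1, where
   (a1, a2, a3) = (h, h + s, h + s + t). *)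
Definition sqnorm_gap (R : pzRingType) (h s t v : R) : R :=
  (3 + v) * ((2 * h + s + t + 1) * v + t - s) * (3 * v + (s + t) * (1 - v))
  + (1 - v) * (2 * s + t - h * v) ^+ 2.

(** For v < 1, multiplication by 1 - v turns the gap into X^2 minus a term that depends on s and t
    only through s + t. With s + t fixed, X is bounded below by its value at h = 1, t = 0 if v > 0,
    and -X by its value at h = 1, s = 0 if v < 0. *)
Lemma sqnorm_gap_gt0 (R : realFieldType) (h s t v : R) :
  1 <= h -> 0 <= s -> 0 <= t -> 0 < s + t -> -3 <= v <= 1 -> 0 < sqnorm_gap h s t v.
Proof.
move=> h1 s0 t0 st /andP[v3]; rewrite le_eqVlt => /predU1P[->|v1].
  rewrite /sqnorm_gap; have -> : (3 + 1) * ((2 * h + s + t + 1) * 1 + t - s) *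
    (3 * 1 + (s + t) * (1 - 1)) + (1 - 1) * (2 * s + t - h * 1) ^+ 2
    = 24 * h + 24 * t + 12 by ring.
  by lra.
pose B := 3 * v + (s + t) * (1 - v).
pose X := (1 - v) * (s + 2 * t + v * (h + s + t)) + 9 * v + 3 * v ^+ 2.
have v1' : 0 < 1 - v by rewrite subr_gt0.
(* complete the square in 2 s + t - h v *)
rewrite -(pmulr_rgt0 _ v1').
have -> : (1 - v) * sqnorm_gap h s t v = X ^+ 2 - 4 * v * (v + 2) * (3 + v) * B.
  by rewrite /sqnorm_gap /X /B; ring.
rewrite subr_gt0.
have [v0|v0|v0] := ltrgt0P v; last first.
- have -> : X = s + 2 * t by rewrite /X v0; ring.
  by rewrite v0 mulr0 !mul0r exprn_gt0 //; lra.
- pose w := - v; have w0 : 0 < w by rewrite oppr_gt0.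
  have w3 : w <= 3 by rewrite /w; lra.
  pose b := (w - 2) * B.
  have -> : 4 * v * (v + 2) * (3 + v) * B = 4 * w * (3 - w) * b.
    by rewrite /b /w; ring.
  have X_le : w ^+ 2 + 4 * w + b <= - X.
    rewrite -subr_ge0.
    have -> : - X - (w ^+ 2 + 4 * w + b) = (1 + w) * (w * (h - 1) + s).
      by rewrite /X /b /B /w; ring.
    by rewrite mulr_ge0 ?addr_ge0 ?mulr_ge0 ?subr_ge0 // ltW.
  (* For b >= 0 the lower bound on -X is nonnegative and can be squared. For b < 0 the subtracted
     term is negative, except at w = 3, where it is 0 and the bound gives -X > 0. *)
  rewrite -sqrrN; have [b0|b0] := leP 0 b.
    have ab0 : 0 <= w ^+ 2 + 4 * w + b.
      by rewrite !addr_ge0 ?sqr_ge0 // mulr_ge0 // ltW.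
    apply: lt_le_trans (_ : (w ^+ 2 + 4 * w + b) ^+ 2 <= _); last first.
      by rewrite ler_pXn2r ?nnegrE // (le_trans ab0).
    rewrite -subr_gt0.
    have -> : (w ^+ 2 + 4 * w + b) ^+ 2 - 4 * w * (3 - w) * b =
      (w ^+ 2 + 4 * w - b) ^+ 2 + 4 * b * (2 * w ^+ 2 + w) by ring.
    have [->|bn] := eqVneq b 0.
      by rewrite subr0 mulr0 mul0r addr0 exprn_gt0 // addr_gt0 ?exprn_gt0 // mulr_gt0.
    have b0' : 0 < b by rewrite lt_neqAle eq_sym bn.
    rewrite ltr_wpDl ?sqr_ge0 //; apply: mulr_gt0; first exact: mulr_gt0.
    by rewrite addr_gt0 // mulr_gt0 // exprn_gt0.
  have [w3'|w3'] := ltP w 3.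
    apply: lt_le_trans (sqr_ge0 _).
    by rewrite pmulr_rlt0 // !mulr_gt0 // subr_gt0.
  have we : w = 3 by apply/eqP; rewrite eq_le w3.
  have -> : 4 * w * (3 - w) * b = 0 by rewrite we; ring.
  rewrite exprn_gt0 // (lt_le_trans _ X_le) // /b /B.
  have -> : v = -3 by rewrite -we opprK.
  by rewrite we; lra.
- pose y := (s + t) * (1 - v).
  pose Y := y * (1 + v) + 10 * v + 2 * v ^+ 2.
  have y0 : 0 < y by rewrite mulr_gt0.
  have Y0 : 0 <= Y by rewrite /Y; clearbody y; nra.
  have YX : Y <= X.
    rewrite -subr_ge0.
    have -> : X - Y = (1 - v) * (t + v * (h - 1)) by rewrite /X /Y /y; ring.
    by rewrite mulr_ge0 ?(ltW v1') // addr_ge0 // mulr_ge0 ?(ltW v0) // subr_ge0.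
  apply: lt_le_trans (_ : Y ^+ 2 <= _); last first.
    by rewrite ler_pXn2r ?nnegrE // (le_trans Y0).
  rewrite -subr_gt0.
  have -> : Y ^+ 2 - 4 * v * (v + 2) * (3 + v) * B =
    (y - 2 * v * (1 - v)) ^+ 2 + y ^+ 2 * (v * (2 + v))
    + 4 * v ^+ 2 * (1 - v) * (6 + 3 * v) by rewrite /Y /B -/y; ring.
  have vv0 : 0 < v * (2 + v) by rewrite mulr_gt0 // addr_gt0.
  apply: ltr_wpDl; first by rewrite addr_ge0 ?sqr_ge0 // mulr_ge0 ?sqr_ge0 // ltW.
  by rewrite !mulr_gt0 ?exprn_gt0 // addr_gt0 // mulr_gt0.
Qed.

(** With c = cos u, the right side is |L|^2, the product of the squared moduli of z - z0 and z + p +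
    q/z; the left is M^2, by cos^2 (u/2) = (1 + c)/2. Four times the difference is [sqnorm_gap] at v
    = 2c - 1. *)
Lemma cubic_factor_sqnorm_gt (R : realFieldType) (a1 a2 a3 z0 p q c : R) :
  1 <= a1 -> a1 <= a2 -> a2 <= a3 -> a1 < a3 -> -1 <= c <= 1 ->
  a3 = p - z0 -> a2 = p * z0 - q -> a1 + 1 = - (q * z0) ->
  (1 + c) / 2 * ((1 - a3) * (2 * c - 1) + (a2 - a1)) ^+ 2 <
  ((c - z0) ^+ 2 + (1 - c ^+ 2)) *
  (((1 + q) * c + p) ^+ 2 + (1 - q) ^+ 2 * (1 - c ^+ 2)).
Proof.
move=> h1 h12 h23 h13 cI e3 e2 e1.
have G : 0 < sqnorm_gap a1 (a2 - a1) (a3 - a2) (2 * c - 1) by apply: sqnorm_gap_gt0; lra.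
rewrite -subr_gt0 -(pmulr_rgt0 _ (ltr0n R 4)).
congr (_ < _): G; rewrite /sqnorm_gap.
have -> : a1 = - (q * z0) - 1 by rewrite -e1; ring.
by rewrite e2 e3; field.
Qed.

(** * Roots of P *)

(* The identity horner_chebP_cos with its common factor 2 cos(2t) - 1
   cancelled, so that it also carries information where cos(2t) = 1/2. *)
Lemma horner_chebP_cos_eq (R : realType) (h : int) n (t : R) :
  let c m := cos (m * t) in
  c 1 * (chebP R h h h n).[2 * cos (2 * t)] =
  c (12 * n%:R + 3) + (h%:~R + 1) * c (12 * n%:R + 1) + (1 - h%:~R) * c 1.
Proof.
move=> c; rewrite horner_chebP.
have prod j k : (0 < k)%N -> c 1 * (chebT R (6 * j + k)).[2 * cos (2 * t)] =
    c (12 * j%:R + 2 * k%:R + 1) + c (12 * j%:R + 2 * k%:R - 1).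
  move=> k0; rewrite horner_chebT_cos; last lia.
  by rewrite mulr_cos_cos /c; congr (cos _ + cos _); ring.
have e (x y : R) : x = y -> c x = c y by move=> ->.
have tele : c 1 * \sum_(0 <= j < n)
     (- (h%:~R * (chebT R (6 * j + 1)).[2 * cos (2 * t)])
      + h%:~R * (chebT R (6 * j + 2)).[2 * cos (2 * t)]
      - h%:~R * (chebT R (6 * j + 3)).[2 * cos (2 * t)]
      + h%:~R * (chebT R (6 * j + 4)).[2 * cos (2 * t)]
      - h%:~R * (chebT R (6 * j + 5)).[2 * cos (2 * t)]
      + h%:~R * (chebT R (6 * j + 6)).[2 * cos (2 * t)]) =
   h%:~R * (c (12 * n%:R + 1) - c 1).
  rewrite mulr_sumr.
  elim: n => [|n IH].
    by rewrite big_geq // mulr0 !add0r subrr mulr0.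
  rewrite big_nat_recr //= IH !(mulrDr (c 1)) !mulrN !(mulrCA (c 1)) !prod //.
  have s : n.+1%:R = n%:R + 1 :> R by rewrite -natr1.
  rewrite (e (12 * n.+1%:R + 1) (12 * n%:R + 2 * 6 + 1)); last by rewrite s; ring.
  rewrite (e (12 * n%:R + 2 * 1 + 1) (12 * n%:R + 2 * 2 - 1)); last by ring.
  rewrite (e (12 * n%:R + 2 * 2 + 1) (12 * n%:R + 2 * 3 - 1)); last by ring.
  rewrite (e (12 * n%:R + 2 * 3 + 1) (12 * n%:R + 2 * 4 - 1)); last by ring.
  rewrite (e (12 * n%:R + 2 * 4 + 1) (12 * n%:R + 2 * 5 - 1)); last by ring.
  rewrite (e (12 * n%:R + 2 * 5 + 1) (12 * n%:R + 2 * 6 - 1)); last by ring.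
  rewrite (e (12 * n%:R + 1) (12 * n%:R + 2 * 1 - 1)); last by ring.
  ring.
rewrite !mulrDr tele prod // mulr1.
rewrite (e (12 * n%:R + 2 * 1 + 1) (12 * n%:R + 3)); last by ring.
rewrite (e (12 * n%:R + 2 * 1 - 1) (12 * n%:R + 1)); last by ring.
ring.
Qed.

(** A sign change puts z0 between -(a3 + 2) and -(a1 + 1), whence q = -(a1 + 1)/z0 <= 1. The last
    two inequalities are L(1) > 0 and L(-1) > 0 divided by 1 - z0 and -1 - z0; with q <= 1 they
    confine the roots of the quadratic factor to the closed unit disc. *)
Lemma cubic_factorization (R : rcfType) (a1 a2 a3 : R) :
  1 <= a1 -> a1 <= a2 -> a2 <= a3 ->
  exists z0 p q, [/\ z0 < -1, a3 = p - z0, a2 = p * z0 - q, a1 + 1 = - (q * z0) &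
    [/\ q <= 1, a1 < a3 -> q < 1, 0 < 1 + p + q & 0 < 1 - p + q]].
Proof.
move=> h1 h12 h23.
pose L : {poly R} := 'X^3 + a3 *: 'X^2 - a2 *: 'X + (a1 + 1)%:P.
have LE z : L.[z] = cubicL a1 a2 a3 z.
  by rewrite /L /cubicL !(hornerD, hornerN, hornerZ, hornerXn, hornerX, hornerC).
have Lr : L.[- (a1 + 1)] = (a1 + 1) * ((a1 + 1) * (a3 - a1) + (a2 - a1)).
  by rewrite LE /cubicL; ring.
have Lr0 : 0 <= L.[- (a1 + 1)] by rewrite Lr; nra.
have Ll0 : L.[- (a3 + 2)] < 0.
  have -> : L.[- (a3 + 2)] = (a3 + 2) * (a2 - 2 * (a3 + 2)) + a1 + 1.
    by rewrite LE /cubicL; ring.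
  nra.
have [||z0 /itvP zI /rootP] := @polyrcf.poly_ivt R L (- (a3 + 2)) (- (a1 + 1)).
- by lra.
- by rewrite mulr_le0_ge0 // ltW.
rewrite LE /cubicL => Lz0.
have z1 : z0 <= - (a1 + 1) by rewrite zI.
have z0n : z0 < 0 by lra.
have zN0 : z0 != 0 by rewrite lt_eqF.
pose q := - ((a1 + 1) / z0); pose p := a3 + z0.
have e1 : a1 + 1 = - (q * z0) by rewrite /q; field.
have e2 : a2 = p * z0 - q.
  have az : a2 * z0 = z0 ^+ 3 + a3 * z0 ^+ 2 + (a1 + 1) by lra.
  by apply: (mulIf zN0); rewrite az /p /q; field.
have e3 : a3 = p - z0 by rewrite /p; ring.
have q_le1 : q <= 1 by nra.
exists z0, p, q; split=> //; first by lra.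
split=> //.
(* q = 1 would force z0 = -(a1 + 1), where L is positive once a1 < a3. *)
- move=> h13; rewrite lt_neqAle q_le1 andbT; apply/eqP => q1.
  have z0E : z0 = - (a1 + 1) by rewrite e1 q1; ring.
  have : 0 < L.[- (a1 + 1)] by rewrite Lr; nra.
  by rewrite -z0E LE /cubicL Lz0 ltxx.
- have : (1 - z0) * (1 + p + q) = a3 - a2 + a1 + 2 by rewrite e2 e3 -[a1](addrK 1) e1; ring.
  nra.
- have : (-1 - z0) * (1 - p + q) = a3 + a2 + a1 by rewrite e2 e3 -[a1](addrK 1) e1; ring.
  nra.
Qed.

Lemma cubicL_factor (R : comPzRingType) (z0 p q a1 a2 a3 z : R) :
  a3 = p - z0 -> a2 = p * z0 - q -> a1 + 1 = - (q * z0) ->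
  cubicL a1 a2 a3 z = (z - z0) * (z ^+ 2 + p * z + q).
Proof. by move=> e3 e2 e1; rewrite /cubicL e3 e2 e1; ring. Qed.

(** p < 1 + q <= 2 makes the quadratic decreasing left of -1, and its value at -1 is 1 - p + q >
    0. *)
Lemma quadratic_gt0 (R : realFieldType) (p q z : R) :
  q <= 1 -> 0 < 1 - p + q -> z < -1 -> 0 < z ^+ 2 + p * z + q.
Proof. by nra. Qed.

(** The last factor is X - 1 at the point 2 cos (2t): moving it to P leaves cos t, positive on the
    whole range, at the price of one extra root 1. *)
Lemma cos_tripler (R : realType) (t : R) : cos (3 * t) = cos t * (2 * cos (2 * t) - 1).
Proof.
have -> : 3 * t = t *+ 2 + t by ring.
have -> : 2 * t = t *+ 2 by ring.
rewrite cosD cos_mulr2n sin_mulr2n; ring: (sin2cos2 t).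
Qed.

Lemma cos_sq_half (R : realType) (t : R) : cos t ^+ 2 = (1 + cos (2 * t)) / 2.
Proof. by rewrite (mulr_natl t 2) cos_mulr2n; field. Qed.

Lemma sign_of_phase (R : realType) (k : nat) (g y rho M Phi : R) :
  0 < g -> g * y = rho * cos Phi + M -> Phi = k%:R * pi -> 0 <= rho ->
  M ^+ 2 < rho ^+ 2 -> 0 < (-1) ^+ k * y.
Proof.
move=> g0 gy PhiE r0 Mr; rewrite -(pmulr_rgt0 _ g0) mulrCA gy PhiE cos_natrpi.
rewrite mulrDr mulrCA -expr2 sqrr_sign mulr1.
have Mr' : `|M| < rho.
  by rewrite -(ger0_norm r0) -ltr_sqr ?nnegrE ?normr_ge0 // !real_normK ?num_real.
have : `|(-1) ^+ k * M| < rho by rewrite normrM normr_sign mul1r.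
by rewrite ltr_norml => /andP[]; lra.
Qed.

(* The argument of z^(6n-1/2) L(z) at z = e^(iu): the quadratic factor is
   z^2 + p z + q = z ((1 + q) cos u + p + i (1 - q) sin u). *)
Definition phase (R : realType) n (z0 p q u : R) : R :=
  (6 * n%:R + 2^-1) * u + uarg (cos u - z0) (sin u)
  + uarg ((1 + q) * cos u + p) ((1 - q) * sin u).

(** The phase for h1 = h2 = h3: the quadratic factor, then z^2 - z + 1, has been cancelled and only
    z - z0 contributes. *)
Definition phase_eq (R : realType) n (z0 u : R) : R :=
  (6 * n%:R + 2^-1) * u + uarg (cos u - z0) (sin u).

Lemma cos_sub_gt0 (R : realType) (z0 u : R) : z0 < -1 -> 0 < cos u - z0.
Proof. by move=> z1; have := cos_geN1 u; lra. Qed.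

Lemma quadratic_phase_off_cut (R : realType) (p q u : R) : q < 1 -> 0 < 1 + p + q ->
  0 <= u < pi -> 0 < (1 + q) * cos u + p \/ (1 - q) * sin u != 0.
Proof.
move=> q1 pq /andP[]; rewrite le_eqVlt => /predU1P[<- _|u0 upi].
  by left; rewrite cos0; lra.
by right; rewrite mulf_neq0 // gt_eqF ?subr_gt0 // sin_gt0_pi // u0.
Qed.

Lemma half_cos_gt0 (R : realType) (u : R) : 0 <= u < pi -> 0 < cos (u / 2).
Proof.
move=> /andP[u0 upi]; have := pi_gt0 R => pi0.
by apply: cos_gt0_pihalf; lra.
Qed.

Lemma horner_chebP_sign (R : realType) (h1 h2 h3 : int) (z0 p q u : R) n k :
  let a1 : R := h1%:~R in let a2 : R := h2%:~R in let a3 : R := h3%:~R in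
  1 <= a1 -> a1 <= a2 -> a2 <= a3 -> a1 < a3 ->
  z0 < -1 -> a3 = p - z0 -> a2 = p * z0 - q -> a1 + 1 = - (q * z0) ->
  q < 1 -> 0 < 1 + p + q -> 0 <= u < pi ->
  phase n z0 p q u = k%:R * pi ->
  0 < (-1) ^+ k * (('X - 1%:P) * chebP R h1 h2 h3 n).[2 * cos u].
Proof.
move=> a1 a2 a3 g1 g12 g23 g13 z1 e3 e2 e1 q1 pq uI Ph.
have [c1 s1] := uargP (or_introl (cos_sub_gt0 u z1) : _ \/ sin u != 0).
have [c2 s2] := uargP (quadratic_phase_off_cut q1 pq uI).
move: c1 s1 c2 s2.
set r1 := Num.sqrt _; set f1 := uarg _ _; set r2 := Num.sqrt _; set f2 := uarg _ _.
move=> c1 s1 c2 s2.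
have uE : 2 * (u / 2) = u by field.
have sc : sin u ^+ 2 = 1 - cos u ^+ 2 := sin2cos2 u.
apply: (@sign_of_phase _ k (cos (u / 2)) _ (r1 * r2)
  ((1 - a3) * cos (3 * (u / 2)) + (a2 - a1) * cos (u / 2)) (phase n z0 p q u)) => //.
- exact: half_cos_gt0.
- have := horner_chebP_cos h1 h2 h3 n (u / 2).
  rewrite /= mul1r cos_tripler uE -/a1 -/a2 -/a3 hornerM hornerXsubC => E.
  rewrite mulrA E; congr (_ + _).
  (* B is the argument of z^(6n+1/2); the cosines at B + 2u, B + u, B and B - u are the real parts
     of the four powers in z^(6n-1/2) L(z). *)
  pose B : R := (6 * n%:R + 2^-1) * u.
  rewrite e3 e2 e1 /phase -/f1 -/f2 -/B.
  have -> : (12 * n%:R + 5) * (u / 2) = B + (u + u) by rewrite /B; field.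
  have -> : (12 * n%:R + 3) * (u / 2) = B + u by rewrite /B; field.
  have -> : (12 * n%:R + 1) * (u / 2) = B by rewrite /B; field.
  have -> : (12 * n%:R - 1) * (u / 2) = B - u by rewrite /B; field.
  have -> : r1 * r2 * cos (B + f1 + f2) =
     cos B * ((r1 * cos f1) * (r2 * cos f2) - (r1 * sin f1) * (r2 * sin f2))
     - sin B * ((r1 * sin f1) * (r2 * cos f2) + (r1 * cos f1) * (r2 * sin f2)).
    by rewrite !cosD sinD; ring.
  rewrite c1 s1 c2 s2 !(cosD, sinD) cosN sinN.
  ring: sc.
- by rewrite mulr_ge0 ?sqrtr_ge0.
- rewrite cos_tripler uE [(1 - a3) * _]mulrCA [(a2 - a1) * _]mulrC -mulrDr.
  rewrite !exprMn cos_sq_half uE.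
  rewrite !sqr_sqrtr ?addr_ge0 ?sqr_ge0 // exprMn sc.
  apply: cubic_factor_sqnorm_gt => //.
  by rewrite cos_geN1 cos_le1.
Qed.

Lemma horner_chebP_sign_eq (R : realType) (h : int) (u : R) n k :
  let a : R := h%:~R in
  1 <= a -> 0 <= u < pi -> phase_eq n (- (a + 1)) u = k%:R * pi ->
  0 < (-1) ^+ k * (chebP R h h h n).[2 * cos u].
Proof.
move=> a a1 uI Ph; have z1 : - (a + 1) < -1 by lra.
have [c1 s1] := uargP (or_introl (cos_sub_gt0 u z1) : _ \/ sin u != 0).
move: c1 s1; set r1 := Num.sqrt _; set f1 := uarg _ _ => c1 s1.
have uE : 2 * (u / 2) = u by field.
have sc : sin u ^+ 2 = 1 - cos u ^+ 2 := sin2cos2 u.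
apply: (@sign_of_phase _ k (cos (u / 2)) _ r1 ((1 - a) * cos (u / 2))
  (phase_eq n (- (a + 1)) u)) => //.
- exact: half_cos_gt0.
- have := horner_chebP_cos_eq h n (u / 2).
  rewrite /= mul1r uE -/a => ->; congr (_ + _).
  pose B : R := (6 * n%:R + 2^-1) * u.
  rewrite /phase_eq -/f1 -/B.
  have -> : (12 * n%:R + 3) * (u / 2) = B + u by rewrite /B; field.
  have -> : (12 * n%:R + 1) * (u / 2) = B by rewrite /B; field.
  have -> : r1 * cos (B + f1) = cos B * (r1 * cos f1) - sin B * (r1 * sin f1).
    by rewrite !cosD; ring.
  by rewrite c1 s1 !cosD; ring.
- by rewrite sqrtr_ge0.
- rewrite exprMn cos_sq_half uE sqr_sqrtr ?addr_ge0 ?sqr_ge0 // sc.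
  rewrite -subr_gt0.
  (* The difference is affine in cos u, hence a combination of 1 + cos u and 1 - cos u; both
     coefficients are positive. *)
  have -> : (cos u - - (a + 1)) ^+ 2 + (1 - cos u ^+ 2)
      - (1 - a) ^+ 2 * ((1 + cos u) / 2) =
    (1 + cos u) * (3 * a + 3 / 2) + (1 - cos u) * (a ^+ 2 / 2) by field.
  have := cos_geN1 u; rewrite le_eqVlt => /predU1P[<-|cN1].
    by rewrite addrN mul0r add0r mulr_gt0 // divr_gt0 ?exprn_gt0 //; lra.
  have cu := cos_le1 u.
  apply: ltr_pwDl; first by apply: mulr_gt0; lra.
  by rewrite mulr_ge0 ?divr_ge0 ?sqr_ge0 // subr_ge0.
Qed.

Lemma continuous_mull (R : realType) (c a : R) :
  {for a, continuous (fun u => c * u)}.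
Proof. by apply: cvgMr; exact: cvg_id. Qed.

Lemma continuous_phase (R : realType) n (z0 p q u : R) :
  z0 < -1 -> q < 1 -> 0 < 1 + p + q -> 0 <= u < pi ->
  {for u, continuous (phase n z0 p q)}.
Proof.
move=> z1 q1 pq uI.
have cC : {for u, continuous (@cos R)} by exact: continuous_cos.
have cS : {for u, continuous (@sin R)} by exact: continuous_sin.
apply: cvgD; first (apply: cvgD; first exact: continuous_mull).
  apply: (@continuous_uarg R (fun u => cos u - z0) (@sin R)) => //.
    by left; exact: cos_sub_gt0.
  by apply: cvgB => //; exact: cvg_cst.
apply: (@continuous_uarg R (fun u => (1 + q) * cos u + p) (fun u => (1 - q) * sin u)).
- exact: quadratic_phase_off_cut.
- by apply: cvgD; [apply: cvgM => //; exact: cvg_cst|exact: cvg_cst].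
- by apply: cvgM => //; exact: cvg_cst.
Qed.

Lemma continuous_phase_eq (R : realType) n (z0 u : R) :
  z0 < -1 -> {for u, continuous (phase_eq n z0)}.
Proof.
move=> z1; apply: cvgD; first exact: continuous_mull.
apply: (@continuous_uarg R (fun u => cos u - z0) (@sin R)) => //.
- by left; exact: cos_sub_gt0.
- by apply: cvgB; [exact: continuous_cos|exact: cvg_cst].
- exact: continuous_sin.
Qed.

Lemma uarg_0 (R : realType) (x : R) : uarg x 0 = 0.
Proof. by rewrite /uarg mul0r atan0 mulr0. Qed.

Lemma uarg_sin_ge0 (R : realType) (z0 u : R) : z0 < -1 -> 0 <= u < pi ->
  0 <= uarg (cos u - z0) (sin u).
Proof.
move=> z1 /andP[u0 upi]; apply: uarg_ge0; first by rewrite sin_ge0_pi // u0 ltW.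
by left; exact: cos_sub_gt0.
Qed.

Lemma double_cos_points (R : realType) m (u : nat -> R) :
  (forall k, (k <= m)%N -> 0 <= u k < pi) ->
  (forall k, (k < m)%N -> u k < u k.+1) ->
  [/\ -2 < 2 * cos (u m), 2 * cos (u 0%N) <= 2 &
      forall k, (k < m)%N -> 2 * cos (u k.+1) < 2 * cos (u k)].
Proof.
move=> uI du; have pi0 := pi_gt0 R.
have I (x : R) : 0 <= x <= pi -> x \in `[0, pi] by rewrite in_itv.
have Iu k : (k <= m)%N -> u k \in `[0, pi].
  by move=> /uI /andP[u0 upi]; rewrite I // u0 ltW.
split.
- have : cos pi < cos (u m).
    by rewrite ltr_cos ?Iu ?I ?lexx ?andbT ?ltW //; have /andP[] := uI m (leqnn m).
  by rewrite cospi; lra.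
- by have := cos_le1 (u 0%N); lra.
- by move=> k km; rewrite ltr_pM2l // ltr_cos ?Iu ?du // ltnW.
Qed.

Lemma horner_chebP_N2_gt0 (R : realFieldType) (h1 h2 h3 : int) n :
  0 < h1 -> h1 <= h2 -> h2 <= h3 -> (0 < n)%N -> 0 < (chebP R h1 h2 h3 n).[-2].
Proof.
move=> h1_gt0 h12 h23 n0; rewrite horner_chebP_N2 subr_gt0.
have : 1 <= n%:R :> R by rewrite ler1n.
have : 3 <= (h1 + h2 + h3)%:~R :> R by rewrite (ler_int R 3); lia.
by nra.
Qed.

Lemma chebP_roots (R : realType) (h1 h2 h3 : int) n :
  0 < h1 -> h1 <= h2 -> h2 <= h3 -> (0 < n)%N ->
  exists y0 (s : seq R),
    [/\ y0 < -2, all (fun r => -2 < r < 2) s, uniq (y0 :: s),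
        chebP R h1 h2 h3 n %| \prod_(r <- y0 :: s) ('X - r%:P) &
        root (chebP R h1 h2 h3 n) y0].
Proof.
move=> h1_gt0 h12 h23 n0; set P := chebP R h1 h2 h3 n.
pose a1 : R := h1%:~R; pose a2 : R := h2%:~R; pose a3 : R := h3%:~R.
have g1 : 1 <= a1 by rewrite /a1 (ler_int R 1).
have g12 : a1 <= a2 by rewrite ler_int.
have g23 : a2 <= a3 by rewrite ler_int.
have [szP mP] := chebP_size_monic R h1 h2 h3 n.
have PN2 : 0 < P.[-2] by exact: horner_chebP_N2_gt0.
have [e13|n13] := eqVneq h1 h3.
  have e2 : h2 = h1 by lia.
  have z1 : - (a1 + 1) < -1 by lra.
  (* Here P itself, of degree 6n + 1, is split, so the points stop at index 6n - 1; in the other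
     case (X - 1) P has degree 6n + 2 and they go up to 6n. *)
  have [||x /andP[x0 xpi]|u [Pu uI du u0]] :=
    @phase_points R (phase_eq n (- (a1 + 1))) (6 * n).-1.
  - by move=> x _; exact: continuous_phase_eq.
  - by rewrite /phase_eq mulr0 sin0 uarg_0 addr0.
  - rewrite /phase_eq ler_wpDr ?uarg_sin_ge0 ?x0 // ler_wpM2r // lerD2r.
    by rewrite -natrM ler_nat leq_pred.
  have [xm xx dx] := double_cos_points uI du.
  have [|k km||y0 [s [yl sI us qE]]] :=
    @alternating_split R P (6 * n).-1 (fun k => 2 * cos (u k)) mP _ xx xm dx.
  - by rewrite szP; lia.
  - by rewrite /P -e13 e2; apply: horner_chebP_sign_eq; [exact: g1|exact: uI|exact: Pu].
  - by rewrite prednK ?muln_gt0 // exprN1_muln6 mul1r.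
  exists y0, s; split=> //; first by rewrite -qE dvdpp.
  by rewrite qE root_prod_XsubC mem_head.
have g13 : a1 < a3 by rewrite ltr_int; lia.
have [z0 [p [q [z1 e3 e2 e1 [_ /(_ g13) q1 pq _]]]]] := cubic_factorization g1 g12 g23.
have [||x /andP[x0 xpi]|u [Pu uI du u0]] :=
  @phase_points R (phase n z0 p q) (6 * n).
- by move=> x xI; exact: continuous_phase.
- by rewrite /phase mulr0 sin0 mulr0 !uarg_0 !addr0.
- rewrite /phase natrM -addrA ler_wpDr // addr_ge0 ?uarg_sin_ge0 ?x0 //.
  apply: uarg_ge0; last by apply: quadratic_phase_off_cut => //; rewrite x0.
  by rewrite mulr_ge0 ?sin_ge0_pi ?x0 ?(ltW xpi) // subr_ge0 ltW.
have [xm xx dx] := double_cos_points uI du.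
have mQ : ('X - 1%:P) * P \is monic by rewrite monicMl ?monicXsubC.
have [|k km||y0 [s [yl sI us qE]]] :=
  @alternating_split R (('X - 1%:P) * P) (6 * n) (fun k => 2 * cos (u k)) mQ _ xx xm dx.
- by rewrite size_Mmonic ?polyXsubC_eq0 // size_XsubC szP addn2.
- by apply: horner_chebP_sign e3 e2 e1 q1 pq _ _ => //; [exact: uI|exact: Pu].
(* At -2 the factor X - 1 is -3, which supplies the sign required at index 6n + 1. *)
- rewrite hornerM hornerXsubC exprS exprN1_muln6.
  by nra.
exists y0, s; split=> //; first by rewrite -qE dvdp_mull // dvdpp.
have : root (('X - 1%:P) * P) y0 by rewrite qE root_prod_XsubC mem_head.
by rewrite rootM root_XsubC => /predU1P[y1|//]; move: yl; rewrite y1; lra.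
Qed.

(** * Limits *)

(** For t = pi/(12n) a shift by 12n t = pi only flips the sign of a cosine, so n enters only through
    y. As y tends to 1 the right side tends to -1 - 2 h1 - 2 (h3 - h2) < 0. *)
Lemma horner_chebP_pi6n (R : realType) (h1 h2 h3 : int) n : (0 < n)%N ->
  let y : R := 2 * cos (pi / (6 * n%:R)) - 1 in
  y * (chebP R h1 h2 h3 n).[2 * cos (pi / (6 * n%:R))] =
  - y ^+ 2 - 2 * h3%:~R * y + 2 * (h2%:~R - h1%:~R).
Proof.
move=> n0 y; have nN0 : n%:R != 0 :> R by rewrite pnatr_eq0 -lt0n.
have n1 : 1 <= n%:R :> R by rewrite ler1n.
pose t : R := pi / (12 * n%:R); have pi0 := pi_gt0 R.
have tE : 2 * t = pi / (6 * n%:R) by rewrite /t; field.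
have t12 : 12 * n%:R * t = pi by rewrite /t; field.
have ct0 : 0 < cos t.
  by apply: cos_gt0_pihalf; apply/andP; split; nra.
have := horner_chebP_cos h1 h2 h3 n t.
have shift (m : R) : cos ((12 * n%:R + m) * t) = - cos (m * t).
  by rewrite mulrDl t12 addrC cosDpi.
rewrite /= -[12 * n%:R - 1]/(12 * n%:R + -1) !shift mulN1r mul1r cosN.
have c5 : cos (5 * t) = cos t * ((y + 1) * y - 1).
  have := mulr_cos_cos (3 * t) (2 * t).
  have -> : 2 * t + 3 * t = 5 * t by ring.
  have -> : 2 * t - 3 * t = - t by ring.
  by rewrite cosN cos_tripler /y -tE => E; lra.
rewrite c5 cos_tripler tE -/y => E.
apply: (mulfI (lt0r_neq0 ct0)); rewrite mulrA E; ring.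
Qed.

Lemma cvg_cos_pi6n (R : realType) :
  (2 * cos (pi / (6 * n%:R)) : R) @[n --> \oo] --> (2 : R).
Proof.
have lim0 : (pi / (6 * n%:R) : R) @[n --> \oo] --> (0 : R).
  have -> : (fun n : nat => pi / (6 * n%:R) : R) = (fun n => pi / 6 * n%:R^-1).
    by apply/funext => n; rewrite invfM mulrA.
  rewrite -[X in _ --> X](mulr0 (pi / 6)); apply: cvgMr.
  apply/gtr0_cvgV0; last exact: cvgr_idn.
  by near=> n; rewrite ltr0n; near: n; exact: nbhs_infty_gt.
have c0 : 2 * cos 0 = 2 :> R by rewrite cos0 mulr1.
rewrite -[X in _ --> X]c0; apply: cvgMr.
exact: (continuous_cvg _ (@continuous_cos R 0) lim0).
Unshelve. all: by end_near.
Qed.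

Lemma chebP_root_near2 (R : realType) (h1 h2 h3 : int) (e : R) :
  0 < h1 -> h2 <= h3 -> 0 < h3 -> 0 < e ->
  \forall n \near \oo, exists2 r, 2 - e < r & root (chebP R h1 h2 h3 n) r.
Proof.
move=> h1_gt0 h23 h3_gt0 e0.
pose a1 : R := h1%:~R; pose a2 : R := h2%:~R; pose a3 : R := h3%:~R.
have g1 : 1 <= a1 by rewrite /a1 (ler_int R 1).
have g3 : 1 <= a3 by rewrite /a3 (ler_int R 1).
have g23 : a2 <= a3 by rewrite ler_int.
(* Within 1/h3 of 2 one has h3 (2 - u) < 1, that is -2 h3 y < 2 - 2 h3 for y = u - 1, which keeps y
   P(u) below -y^2. *)
have d0 : 0 < Num.min e (a3^-1) by rewrite lt_min e0 invr_gt0 (lt_le_trans ltr01).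
have /cvgrPdist_lt /(_ _ d0) := @cvg_cos_pi6n R.
move=> near_cos; near=> n.
have n0 : (0 < n)%N by near: n; exact: nbhs_infty_gt.
have : `|2 - 2 * cos (pi / (6 * n%:R))| < Num.min e a3^-1 by near: n.
rewrite lt_min !ltr_norml => /andP[/andP[_ ce] /andP[_ ca]].
have := horner_chebP_pi6n R h1 h2 h3 n0; rewrite /= -/a1 -/a2 -/a3.
have := cos_le1 (pi / (6 * n%:R) : R); move: ce ca.
set u := 2 * cos _ => ce ca cl E.
have u2 : u <= 2 by rewrite /u; lra.
have a3u : a3 * (2 - u) < 1 by rewrite mulrC -ltr_pdivlMr ?div1r //; lra.
have au : a3^-1 <= 1 by rewrite invf_le1 //; lra.
have Pu : (chebP R h1 h2 h3 n).[u] < 0.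
  rewrite -(pmulr_rlt0 _ (_ : 0 < u - 1)) ?E; last by lra.
  have : 0 < (u - 1) ^+ 2 by rewrite exprn_gt0 //; lra.
  by lra.
have [|r /itvP rI rr] := @polyrcf.poly_ivtoo R (chebP R h1 h2 h3 n) u 2 u2.
  by rewrite horner_chebP_2 pmulr_llt0.
exists r => //; apply: lt_trans (_ : u < r); last by rewrite rI.
by lra.
Unshelve. all: by end_near.
Qed.

Lemma near_lt_expr (R : archiRealFieldType) (w K : R) : 1 < w ->
  \forall n \near \oo, K < w ^+ n.
Proof.
move=> w1; have d0 : 0 < w - 1 by rewrite subr_gt0.
have bern n : 1 + n%:R * (w - 1) <= w ^+ n.
  elim: n => [|n IH]; first by rewrite mul0r addr0.
  have n0 : 0 <= n%:R :> R by [].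
  have wIH : w * (1 + n%:R * (w - 1)) <= w * w ^+ n.
    by rewrite ler_wpM2l // ltW // (lt_trans ltr01).
  have nd : 0 <= n%:R * (w - 1) ^+ 2 by rewrite mulr_ge0 ?sqr_ge0.
  rewrite exprS -natr1; apply: le_trans wIH; nra.
near=> n; apply: lt_le_trans (bern n).
have : K / (w - 1) < n%:R by near: n; exact: nbhs_infty_gtr.
by rewrite ltr_pdivrMr // => /lt_trans -> //; rewrite ltrDr.
Unshelve. all: by end_near.
Qed.

(** 1 + z^3 and z^(6n+1) are both negative, so P and L agree in sign once z^(6n) |L| exceeds |N| +
    |M|; the reciprocal power is at most 1 in absolute value. *)
Lemma chebP_sign_outside (R : realType) (h1 h2 h3 : int) (z : R) :
  let L := cubicL h1%:~R h2%:~R h3%:~R z in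
  z < -1 -> L != 0 ->
  \forall n \near \oo, 0 < (chebP R h1 h2 h3 n).[z + z^-1] * L.
Proof.
move=> L z1 L0.
pose N := 1 + h3%:~R * z - h2%:~R * z ^+ 2 + (h1%:~R + 1) * z ^+ 3.
pose M := (1 - h3%:~R) * (1 + z ^+ 3) + (h2%:~R - h1%:~R) * (z + z ^+ 2).
have z0 : z != 0 by rewrite lt_eqF //; lra.
have z6 : 1 < z ^+ 6.
  have -> : z ^+ 6 = (z ^+ 2) ^+ 3 by ring.
  by rewrite exprn_egt1 //; nra.
have z3 : 1 + z ^+ 3 < 0 by nra.
have K := near_lt_expr ((`|N| + `|M|) / `|L|) z6; near=> n.
have Kn : (`|N| + `|M|) / `|L| < (z ^+ 6) ^+ n by near: n.
have W1 : 1 <= (z ^+ 6) ^+ n by rewrite exprn_ege1 // ltW.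
rewrite -(nmulr_rlt0 _ z3) mulrA.
rewrite (horner_chebP_addV h1 h2 h3 n z0) -/L -/N -/M.
move: Kn W1; move: ((z ^+ 6) ^+ n) => W Kn W1.
have L_gt0 : 0 < `|L| by rewrite normr_gt0.
rewrite ltr_pdivrMr // in Kn.
have Vb : `|(z * W)^-1| <= 1.
  rewrite normfV invf_le1 ?normr_gt0 ?mulf_neq0 //; last by rewrite gt_eqF // (lt_le_trans ltr01).
  by rewrite normrM (ger0_norm (le_trans ler01 W1)) ltr0_norm; nra.
have B : `|(z * W)^-1 * N + M| < W * `|L|.
  apply: le_lt_trans Kn; apply: (le_trans (ler_normD _ _)); rewrite lerD2r.
  by rewrite normrM ler_piMl.
have B2 : ((z * W)^-1 * N + M) * L < W * L ^+ 2.
  apply: (le_lt_trans (ler_norm _)); rewrite normrM -[L ^+ 2]real_normK ?num_real //.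
  by rewrite expr2 mulrA ltr_pM2r.
rewrite -addrA mulrDl; have : 0 < W * L ^+ 2.
  by rewrite mulr_gt0 ?exprn_even_gt0 //; exact: lt_le_trans ltr01 W1.
move: B2; set V := (_ + M) * L; rewrite -[z * W * L * L]mulrA -expr2 -mulrA.
by nra.
Unshelve. all: by end_near.
Qed.

Lemma addV_root (R : rcfType) (y : R) : y < -2 ->
  exists2 z : R, z < -1 & z + z^-1 = y.
Proof.
move=> y2; have d0 : 0 < y ^+ 2 - 4 by nra.
have d1 : Num.sqrt (y ^+ 2 - 4) ^+ 2 = y ^+ 2 - 4 by rewrite sqr_sqrtr // ltW.
have d2 := sqrtr_ge0 (y ^+ 2 - 4).
set d := Num.sqrt _ in d1 d2.
(* The smaller root of z^2 - y z + 1. *)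
pose z := (y - d) / 2; have z1 : z < -1 by rewrite /z; lra.
have z0 : z != 0 by rewrite lt_eqF //; lra.
exists z => //; apply: (mulIf z0); rewrite mulrDl mulVf // /z.
have -> : (y - d) / 2 * ((y - d) / 2) = (y ^+ 2 - 2 * y * d + d ^+ 2) / 4 by field.
by rewrite d1; field.
Qed.

Lemma addV_lt (R : realFieldType) (z w : R) :
  z < -1 -> w < -1 -> (z + z^-1 < w + w^-1) = (z < w).
Proof.
move=> z1 w1.
have z0 : z != 0 by rewrite lt_eqF //; lra.
have w0 : w != 0 by rewrite lt_eqF //; lra.
rewrite -subr_gt0 -[RHS]subr_gt0.
have -> : w + w^-1 - (z + z^-1) = (1 - (z * w)^-1) * (w - z) by field; rewrite z0 w0.
by rewrite pmulr_rgt0 // subr_gt0 invf_lt1; nra.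
Qed.

Lemma addV_ltN2 (R : realFieldType) (z : R) : z < -1 -> z + z^-1 < -2.
Proof.
move=> z1; have z0 : z != 0 by rewrite lt_eqF //; lra.
have z0' : z < 0 by lra.
rewrite -subr_lt0; have -> : z + z^-1 - -2 = (z + 1) ^+ 2 / z by field.
by rewrite pmulr_rlt0 ?invr_lt0 // exprn_even_gt0 //= lt_eqF //; lra.
Qed.

Theorem theorem6p3 (R : realType) (h1 h2 h3 : int)
    (h1_gt0 : 0 < h1) (h12 : h1 <= h2) (h23 : h2 <= h3) :
  exists xm xM : nat -> R,
    (forall n : nat, (1 <= n)%N ->
       [/\ hyperbolic (chebP R h1 h2 h3 n),
           only_root_outside (chebP R h1 h2 h3 n) (xm n),
           xm n < -2
         & largest_root (chebP R h1 h2 h3 n) (xM n)]) /\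
    (exists z0 : R,
       smallest_root (limit_cubic R h1 h2 h3) z0 /\
       xm n @[n --> \oo] --> z0 + z0^-1) /\
    xM n @[n --> \oo] --> (2 : R).
Proof.
pose P n := chebP R h1 h2 h3 n.
have ex n : exists ab : R * R, (1 <= n)%N ->
    [/\ hyperbolic (P n), only_root_outside (P n) ab.1, ab.1 < -2,
        largest_root (P n) ab.2 & root (P n) ab.1].
  (* The premise fails at n = 0, so the pair chosen there is arbitrary. *)
  case: (posnP n) => [->|n0]; first by exists (0, 0).
  have [y0 [s [yl sI us dP ry]]] := chebP_roots R h1_gt0 h12 h23 n0.
  have sub : {subset root (P n) <= y0 :: s} by move=> r; exact: dvdp_split_root dP.
  have [b bmax] := largest_root_exists sub ry.
  exists (y0, b) => _; split=> //; first exact: dvdp_split_hyperbolic dP.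
  split; first exact: dvdp_uniq_split_mup us dP ry.
  move=> r /sub; rewrite in_cons => /predU1P[->|/(allP sI)]; first by rewrite eqxx.
  by rewrite in_itv /= => /andP[r1 r2] _; rewrite !ltW.
have [f fP] := choice ex.
exists (fun n => (f n).1), (fun n => (f n).2); split; first by move=> n /fP[].
pose a1 : R := h1%:~R; pose a2 : R := h2%:~R; pose a3 : R := h3%:~R.
have g1 : 1 <= a1 by rewrite /a1 (ler_int R 1).
have g12 : a1 <= a2 by rewrite ler_int.
have g23 : a2 <= a3 by rewrite ler_int.
have xM_le2 n : (0 < n)%N -> (f n).2 <= 2.
  move=> /fP[_ [_ out] xm2 [rM _] _].
  have [->|/(out _ rM)] := eqVneq (f n).2 (f n).1; first by lra.
  by rewrite in_itv => /andP[].
split; last first.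
  apply/cvgrPdist_lt => e e0; near=> n.
  have n0 : (0 < n)%N by near: n; exact: nbhs_infty_gt.
  have [r re rr] : exists2 r, 2 - e < r & root (P n) r.
    near: n; apply: chebP_root_near2 => //.
    exact: lt_le_trans h1_gt0 (le_trans h12 h23).
  have [_ _ _ [_ /(_ r rr) rM] _] := fP n n0.
  rewrite ger0_norm ?subr_ge0 ?xM_le2 //; lra.
have [z0 [p [q [z1 e3 e2 e1 [q1 _ _ pq]]]]] := cubic_factorization g1 g12 g23.
(* Left of -1 the cubic has the sign of z - z0, so z0 is its smallest root. *)
have Lsgn z : z < -1 -> exists2 d, 0 < d & cubicL a1 a2 a3 z = (z - z0) * d.
  by move=> zl; exists (z ^+ 2 + p * z + q); [exact: quadratic_gt0|exact: cubicL_factor].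
have LE z : (limit_cubic R h1 h2 h3).[z] = cubicL a1 a2 a3 z.
  rewrite /limit_cubic /cubicL !(hornerD, hornerN, hornerZ, hornerXn, hornerX, hornerC).
  by rewrite rmorphD.
exists z0; split.
  split; first by rewrite rootE LE (cubicL_factor _ e3 e2 e1) subrr mul0r.
  move=> y; rewrite rootE LE leNgt => /eqP y0; apply/negP => yz.
  have [d d0 dE] := Lsgn y (lt_trans yz z1).
  have : (y - z0) * d < 0 by rewrite nmulr_rlt0 ?subr_lt0.
  by rewrite -dE y0 ltxx.
pose l := z0 + z0^-1.
have l2 : l < -2 by exact: addV_ltN2.
have PN2 n : (0 < n)%N -> 0 < (P n).[-2].
  exact: horner_chebP_N2_gt0.
(* A sign change between y and -2 yields a root below -2, which can only be x_m. *)
have xm_gt n y : (0 < n)%N -> y < -2 -> (P n).[y] < 0 -> y < (f n).1.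
  move=> n0 y2 Py.
  have [|r /itvP rI rr] := @polyrcf.poly_ivtoo R (P n) y (-2) (ltW y2).
    by rewrite pmulr_llt0 ?PN2.
  have [_ [_ out] xm2 _ _] := fP n n0.
  have [<-|/(out _ rr)] := eqVneq r (f n).1; first by rewrite rI.
  by rewrite in_itv /= => /andP[]; rewrite leNgt rI.
(* The degree 6n + 1 is odd, so P is negative somewhere left of y and the root found there is
   x_m. *)
have xm_lt n y : (0 < n)%N -> y < -2 -> 0 < (P n).[y] -> (f n).1 < y.
  move=> n0 y2 Py.
  have [sP mP] := chebP_size_monic R h1 h2 h3 n.
  have [w wy] := monic_sgr_minfty y mP.
  rewrite sP addn2 /= exprS exprN1_muln6 mulr1 mulN1r oppr_gt0 => Pw.
  have [|r /itvP rI rr] := @polyrcf.poly_ivtoo R (P n) w y (ltW wy).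
    by rewrite pmulr_llt0.
  have [_ [_ out] xm2 _ _] := fP n n0.
  have [<-|/(out _ rr)] := eqVneq r (f n).1; first by rewrite rI.
  have ry : r < y by rewrite rI.
  by rewrite in_itv /= => /andP[]; lra.
(* z + 1/z is increasing for z < -1, so the sign of z - z0 becomes that of y - l. *)
have near_sgn y : y < -2 -> y != l ->
    \forall n \near \oo, 0 < (P n).[y] * (y - l).
  move=> y2 yl; have [z zl zE] := addV_root y2.
  have zz0 : z != z0 by apply: contra_neq yl => zz0; rewrite -zE zz0.
  have [d d0 dE] := Lsgn z zl.
  have L0 : cubicL a1 a2 a3 z != 0 by rewrite dE mulf_neq0 ?subr_eq0 // gt_eqF.
  have := chebP_sign_outside zl L0; apply: filterS => n.
  rewrite dE zE mulrA pmulr_lgt0 //.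
  case: (ltgtP z z0) zz0 => // zz _.
    rewrite nmulr_lgt0 ?subr_lt0 // => Pn.
    by rewrite nmulr_lgt0 // subr_lt0 -zE /l addV_lt.
  rewrite pmulr_lgt0 ?subr_gt0 // => Pn.
  by rewrite pmulr_lgt0 // subr_gt0 -zE /l addV_lt.
apply/cvgrPdist_lt => e e0.
(* The midpoint (l - 2)/2 of l and -2 keeps [y2] below -2 even for large e. *)
pose y1 := l - e / 2; pose y2 := Num.min (l + e / 2) ((l - 2) / 2).
have y1l : y1 < l by rewrite /y1; lra.
have ly2 : l < y2 by rewrite lt_min; apply/andP; split; lra.
have y2N2 : y2 < -2 by rewrite gt_min; apply/orP; right; lra.
have y2e : y2 <= l + e / 2 by rewrite ge_min lexx.
have s1 := near_sgn y1 (lt_trans y1l l2) (negbT (lt_eqF y1l)).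
have s2 := near_sgn y2 y2N2 (negbT (gt_eqF ly2)).
near=> n.
have n0 : (0 < n)%N by near: n; exact: nbhs_infty_gt.
have P1 : 0 < (P n).[y1] * (y1 - l) by near: n.
have P2 : 0 < (P n).[y2] * (y2 - l) by near: n.
rewrite nmulr_lgt0 ?subr_lt0 // in P1; rewrite pmulr_lgt0 ?subr_gt0 // in P2.
have b1 := xm_gt n y1 n0 (lt_trans y1l l2) P1.
have b2 := xm_lt n y2 n0 y2N2 P2.
by rewrite ltr_norml -/l; apply/andP; split; move: b1 b2; rewrite /y1; lra.
Unshelve. all: by end_near.
Qed.
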